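(* Let $r>1/2$ and fix $\beta_0,\beta_1>0$ with $\beta_0+\beta_1\zeta(2r)=1$ (so that the initial error of $\mathcal{H}^{\mathrm{Kor}}_r(\mathbb{T}^d)\hookrightarrow L_\infty(\mathbb{T}^d)$ equals $1$ for all $d$). Then uniform approximation on the unweighted Korobov spaces is polynomially tractable for Monte Carlo methods using linear information: there is a constant $C>0$, which may depend on $r$ but not on $d$ or $\varepsilon$, such that for all $d\in\mathbb{N}$ and $\varepsilon>0$, \[ n^{\mathrm{ran}}\bigl(\varepsilon,\mathcal{H}^{\mathrm{Kor}}_r(\mathbb{T}^d)\hookrightarrow L_\infty(\mathbb{T}^d)\bigr)\le C\,\varepsilon^{-2}\,d\,(1+\log d). \]
   Context: $\mathbb{T}=[0,1)$ is the one-dimensional torus, $\mathbb{T}^d$ the $d$-torus. The Korobov space $\mathcal{H}^{\mathrm{Kor}}_r(\mathbb{T})$ is the real Hilbert space of functions on $\mathbb{T}$ with orthonormal basis $\psi_0:=\sqrt{\beta_0}$, $\psi_{-k}:=\sqrt{\beta_1}k^{-r}\sin(2\pi k\,\cdot)$, $\psi_k:=\sqrt{\beta_1}k^{-r}\cos(2\pi k\,\cdot)$, $k\in\mathbb{N}$; $\mathcal{H}^{\mathrm{Kor}}_r(\mathbb{T}^d)$ is the unweighted tensor product space with orthonormal basis $\psi_{\mathbf{k}}(\mathbf{x})=\prod_{j=1}^d\psi_{k_j}(x_j)$, $\mathbf{k}\in\mathbb{Z}^d$. $\zeta$ is the Riemann zeta function. Randomized setting with linear information: a randomized method is a family $(A_n^{\omega})_{\omega}$,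 indexed by an element of a probability space, of maps $A_n^{\omega}=\phi^{\omega}\circ N^{\omega}$ with $N^{\omega}(f)=(L^{\omega}_1(f),\ldots,L^{\omega}_n(f))$ for continuous linear functionals $L_i^{\omega}$ and $\phi^\omega:\mathbb{R}^n\to L_\infty(\mathbb{T}^d)$; its error is $\sup_{\|f\|\le1}\mathbb{E}\|f-A_n^{\omega}(f)\|_{L_\infty}$; $n^{\mathrm{ran}}(\varepsilon,\cdot)$ is the minimal $n\in\mathbb{N}_0$ such that some randomized method using $n$ pieces of information has error at most $\varepsilon$. *)

(* Defs.v *)
From HB Require Import structures.
From mathcomp Require Import all_boot all_order all_algebra.
From mathcomp Require Import all_classical all_reals all_analysis.
From mathcomp Require Import measurable_realfun.
Set Implicit Arguments. Unset Strict Implicit. Unset Printing Implicit Defensive.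
Import Order.TTheory GRing.Theory Num.Theory.
Import numFieldNormedType.Exports.
Local Open Scope classical_set_scope.
Local Open Scope ring_scope.

Section Korobov.
Variable R : realType.

Definition riemann_zeta (s : R) : \bar R :=
  (\sum_(1 <= k <oo) ((k%:R : R) `^ (- s))%:E)%E.

(** The univariate orthonormal basis of H^Kor_r(T), indexed by k : int. *)
Definition psi1 (r beta0 beta1 : R) (k : int) (x : R) : R :=
  match k with
  | Posz 0 => Num.sqrt beta0
  | Posz n => Num.sqrt beta1 * (n%:R `^ (- r)) * cos (2 * pi * n%:R * x)
  | Negz m => Num.sqrt beta1 * (m.+1%:R `^ (- r)) * sin (2 * pi * m.+1%:R * x)
  end.

Definition mindex (d : nat) := {ffun 'I_d -> int}.
Definition point (d : nat) := 'I_d -> R.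

Definition psi (d : nat) (r beta0 beta1 : R) (k : mindex d) (x : point d) : R :=
  \prod_(j < d) psi1 r beta0 beta1 (k j) (x j).

(** An element f = sum_k c_k psi_k of the Korobov space is represented by its
    coefficient family c in l_2(Z^d); its squared norm is sum_k c_k^2. *)
Definition coeffs (d : nat) := mindex d -> R.

Definition sqnorm (d : nat) (c : coeffs d) : \bar R :=
  (\esum_(k in [set: mindex d]) ((c k) ^+ 2)%:E)%E.

Definition in_korobov (d : nat) (c : coeffs d) : Prop := (sqnorm c < +oo)%E.

Definition rsum (d : nat) (a : mindex d -> R) : R :=
  fine (\esum_(k in [set: mindex d]) (Num.max (a k) 0)%:E)%E
  - fine (\esum_(k in [set: mindex d]) (Num.max (- a k) 0)%:E)%E.

Definition korobov_fun (d : nat) (r beta0 beta1 : R) (c : coeffs d) (x : point d) : R :=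
  rsum (fun k => c k * psi r beta0 beta1 k x).

Definition cont_lin_functional (d : nat) (L : coeffs d -> R) : Prop :=
  (forall (a : R) (c1 c2 : coeffs d), in_korobov c1 -> in_korobov c2 ->
      L (fun k => a * c1 k + c2 k) = a * L c1 + L c2) /\
  exists M : R, forall c : coeffs d, in_korobov c ->
      (((`|L c|) ^+ 2)%:E <= (M ^+ 2)%:E * sqnorm c)%E.

Definition torus (d : nat) : set (point d) :=
  [set x | forall j : 'I_d, 0 <= x j < 1].

Definition lebesgue_null (d : nat) (N : set (point d)) : Prop :=
  forall e : R, 0 < e ->
  exists a b : nat -> point d,
    (forall n j, a n j <= b n j) /\
    (N `<=` \bigcup_n [set x | forall j, a n j <= x j <= b n j]) /\
    (forall m, \sum_(n < m) \prod_(j < d) (b n j - a n j) <= e).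

Definition Linf_norm (d : nat) (g : point d -> R) : \bar R :=
  ereal_inf [set (M%:E)%E | M in
     [set M : R | 0 <= M /\ lebesgue_null [set x | torus x /\ M < `|g x|]]].

Record ran_method (d n : nat) (Omega : Type) := RanMethod {
  info : Omega -> 'I_n -> coeffs d -> R ;
  recon : Omega -> ('I_n -> R) -> point d -> R }.

Definition apply_method (d n : nat) (Omega : Type) (A : ran_method d n Omega)
    (w : Omega) (c : coeffs d) : point d -> R :=
  recon A w (fun i => info A w i c).

Definition in_unit_ball (d : nat) (c : coeffs d) : Prop := (sqnorm c <= 1)%E.

(** n pieces of information suffice to reach error eps: there is a
    randomized method (with continuous linear information functionals and
    measurable error, so that the expectation makes sense) whose error
    sup_{||f|| <= 1} E ||f - A^w f||_infty is at most eps. *)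
Definition ran_achievable (d : nat) (r beta0 beta1 : R) (eps : R) (n : nat) : Prop :=
  exists (dO : measure_display) (Omega : measurableType dO)
         (P : probability Omega R) (A : ran_method d n Omega),
    (forall w i, cont_lin_functional (info A w i)) /\
    (forall c : coeffs d, in_unit_ball c ->
       measurable_fun [set: Omega]
         ((fun w => Linf_norm (fun x => korobov_fun r beta0 beta1 c x
                                        - apply_method A w c x)) : Omega -> \bar R)) /\
    (ereal_sup [set (\int[P]_w Linf_norm (fun x => (korobov_fun r beta0 beta1 c x
                                        - apply_method A w c x)%R))%E
               | c in @in_unit_ball d] <= eps%:E)%E.

(** n^ran(eps, H^Kor_r(T^d) -> L_infty(T^d)): minimal such n (+oo if none). *)
Definition n_ran (d : nat) (r beta0 beta1 : R) (eps : R) : \bar R :=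
  ereal_inf [set ((n%:R : R)%:E)%E | n in ran_achievable d r beta0 beta1 eps].

End Korobov.

(* Main.v *)
Require Import Defs.
From HB Require Import structures.
From mathcomp Require Import all_boot all_order all_algebra.
From mathcomp Require Import all_classical all_reals all_analysis.
From mathcomp Require Import measurable_realfun.
From mathcomp Require Import ring lra.
Import Order.TTheory GRing.Theory Num.Theory.
Import numFieldNormedType.Exports.
Local Open Scope ring_scope.

(** Fix a large box [F] of frequencies; what [f] carries outside [F] is uniformly
small.  With independent random signs [e_(i,k)], the method
[A f = n^-1 sum_i L_i(f) g_i], where [L_i(f) = sum_(k in F) e_(i,k) c_k] and
[g_i = sum_(k in F) e_(i,k) psi_k], is an unbiased estimator of the part of [f] in
[F].  At a fixed point its error is an average of [n] independent centred
products of two Rademacher sums, which has Bernstein-type exponential moments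
because [sum_k psi_k(x)^2 <= 1].  Since [2 r > 1], the canonical metric
[(sum_k (psi_k(x) - psi_k(y))^2)^(1/2)] is Hoelder in [x - y] up to a factor
[sqrt d], so that chaining along refining grids costs an entropy of order
[d (1 + log d)] and bounds the expected uniform error by a multiple of
[sqrt (d (1 + log d) / n)].  For [eps >= 1] the zero method suffices. *)

Set Implicit Arguments.
Unset Strict Implicit.
Unset Printing Implicit Defensive.

(** * Exponential moments of Rademacher sums *)

Section ExpBounds.
Variable R : realType.
Implicit Types x y : R.

Lemma expR_le1Dxexp x : expR x <= 1 + x * expR x.
Proof.
have h := expR_ge1Dx (- x).
have e0 := expR_gt0 x.
have : (1 - x) * expR x <= expR (- x) * expR x by rewrite ler_pM2r.
rewrite -expRD addNr expR0 mulrBl mul1r => h2; lra.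
Qed.

(** For [x >= 0] the bound [expR_le1Dxexp] is inserted into itself; for [x < 0] it is combined with
    [1 + x <= expR x] multiplied by [x]. No smallness of [x] is assumed, since products of
    Rademacher sums are not uniformly bounded. *)
Lemma expR_le_quad x : expR x <= 1 + x + x ^+ 2 * expR `|x|.
Proof.
have h1 := expR_le1Dxexp x; have h2 := expR_ge1Dx x.
case: (lerP 0 x) => x0.
- rewrite ger0_norm //.
  have : x * expR x <= x * (1 + x * expR x) by rewrite ler_wpM2l.
  rewrite expr2; lra.
- have : x * expR x <= x * (1 + x) by rewrite ler_nM2l.
  have : x ^+ 2 * 1 <= x ^+ 2 * expR `|x|.
    by rewrite ler_wpM2l ?sqr_ge0 // -expR0 ler_expR.
  rewrite expr2; lra.
Qed.

Lemma expR_small x : `|x| <= 1 / 2 -> expR x <= 1 + x + 2 * x ^+ 2.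
Proof.
move=> xh.
have h := expR_ge1Dx (- x).
have x1 : x <= 1/2 by rewrite (le_trans _ xh) // ler_norm.
have e0 := expR_gt0 x.
have : (1 - x) * expR x <= expR (- x) * expR x by rewrite ler_pM2r.
rewrite -expRD addNr expR0 => h2.
have p0 : 0 < 1 - x by lra.
rewrite -(ler_pM2l p0); apply: (le_trans h2).
(* This is the excess of [(1 - x) * (1 + x + 2 * x ^+ 2)] over 1. *)
have : 0 <= x^+2 * (1 - 2 * x) by apply: mulr_ge0; [exact: sqr_ge0|lra].
by move=> ?; nra.
Qed.

(** For small [x] the linear terms of the two expansions cancel; once the modulus of [x] exceeds
    [1 / 2], it is at most [2 * x ^+ 2]. *)
Lemma cosh_le_exp x : (expR x + expR (- x)) / 2 <= expR (2 * x ^+ 2).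
Proof.
case: (lerP `|x| (1/2)) => xh.
- have h1 := expR_small xh.
  have h2 : expR (- x) <= 1 + (- x) + 2 * (- x) ^+ 2 by apply: expR_small; rewrite normrN.
  have := expR_ge1Dx (2 * x ^+ 2).
  rewrite sqrrN in h2; lra.
- have e1 : expR x <= expR (2 * x ^+ 2).
    rewrite ler_expR (le_trans (ler_norm _)) // -(real_normK (num_real x)) expr2; nra.
  have e2 : expR (- x) <= expR (2 * x ^+ 2).
    rewrite ler_expR (le_trans (ler_norm _)) // normrN -(real_normK (num_real x)) expr2; nra.
  lra.
Qed.

End ExpBounds.

(** * Expectations over finite sample spaces *)

Section Average.
Variable R : realType.

Definition avg (T : finType) (g : T -> R) : R := #|T|%:R^-1 * \sum_t g t.

Variable T : finType.
Implicit Types g h : T -> R.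

Lemma eq_avg g h : g =1 h -> avg g = avg h.
Proof. by move=> gh; congr (_ * _); apply: eq_bigr => t _. Qed.

Lemma le_avg g h : (forall t, g t <= h t) -> avg g <= avg h.
Proof.
by move=> gh; apply: ler_wpM2l; [rewrite invr_ge0 ler0n|apply: ler_sum => t _].
Qed.

Lemma avgD g h : avg (fun t => g t + h t) = avg g + avg h.
Proof. by rewrite /avg big_split mulrDr. Qed.

Lemma avgZ a g : avg (fun t => a * g t) = a * avg g.
Proof. by rewrite /avg -mulr_sumr mulrCA. Qed.

Lemma avg_sum (I : Type) (s : seq I) (g : I -> T -> R) :
  avg (fun t => \sum_(i <- s) g i t) = \sum_(i <- s) avg (g i).
Proof. by rewrite /avg exchange_big mulr_sumr. Qed.

Lemma avg_cst a : (0 < #|T|)%N -> avg (fun _ : T => a) = a.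
Proof.
move=> T0; rewrite /avg sumr_const -[a *+ _]mulr_natl mulrA mulVf ?mul1r //.
by rewrite pnatr_eq0 -lt0n.
Qed.

Lemma avg_involution (f : T -> T) g : involutive f -> avg (g \o f) = avg g.
Proof.
by move=> fK; rewrite /avg [in RHS](reindex f) //; exists f => t _; exact: fK.
Qed.

End Average.

(** Independence of the samples: the uniform law on [n]-tuples is a product law. *)
Lemma avg_prod (R : realType) (T : finType) (n : nat) (h : T -> R) :
  avg (fun w : {ffun 'I_n -> T} => \prod_i h (w i)) = avg h ^+ n.
Proof.
rewrite /avg card_ffun card_ord exprMn natrX exprVn; congr (_ * _).
by rewrite -(bigA_distr_bigA (fun (_ : 'I_n) t => h t)) prodr_const card_ord.
Qed.

(** * Rademacher sums and products of two of them *)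

Section Rademacher.
Variables (R : realType) (K : finType).
Implicit Types (a b : K -> R) (w : {ffun K -> bool}).

(** Serves both as the information [L_i(f)], with [a] the coefficients of [f], and as the value
    [g_i(x)], with [a] the values of the basis at [x]. *)
Definition signs_dot a w : R := \sum_k a k * (-1) ^+ (w k).

Definition flip (k : K) w : {ffun K -> bool} :=
  [ffun l => if l == k then ~~ w l else w l].

Lemma flipK k : involutive (flip k).
Proof.
move=> w; apply/ffunP => l; rewrite !ffunE.
by case: eqP => // _; rewrite negbK.
Qed.

Lemma card_signs : (0 < #|{ffun K -> bool}|)%N.
Proof. by rewrite card_ffun card_bool expn_gt0. Qed.

(** Averages out the sign of [k] with all other signs held fixed. *)
Lemma avg_flip k (g : {ffun K -> bool} -> R) :
  avg g = avg (fun w => (g w + g (flip k w)) / 2).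
Proof.
under [RHS]eq_avg => w do rewrite mulrC.
rewrite avgZ avgD (avg_involution g (flipK k)).
by field.
Qed.

(** Coordinates are averaged out one at a time: averaging over the sign of [k]
turns [p] into [p - 8 * a k ^+ 2]. *)
Lemma avg_exp_sqr (s : seq K) a (p : R) : uniq s ->
  8 * \sum_(k <- s) a k ^+ 2 + 1 <= p ->
  avg (fun w => expR ((\sum_(k <- s) a k * (-1) ^+ (w k)) ^+ 2 / p))
    <= expR (\sum_(k <- s) a k ^+ 2).
Proof.
elim: s p => [|k s IH] p /=.
  move=> _ _; under eq_avg => w do rewrite big_nil expr0n /= mul0r.
  by rewrite big_nil avg_cst ?card_signs.
move=> /andP[ks us]; rewrite big_cons => hp.
set S := \sum_(k <- s) _ in IH hp *.
have S0 : 0 <= S by apply: sumr_ge0 => i _; exact: sqr_ge0.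
set A := a k ^+ 2 in hp *.
have A0 : 0 <= A by exact: sqr_ge0.
have p1 : 1 <= p by lra.
have p0 : 0 < p by lra.
have q0 : 0 < p - 8 * A by lra.
pose U w := \sum_(l <- s) a l * (-1) ^+ (w l) : R.
have U_flip w : U (flip k w) = U w.
  apply: eq_big_seq => l ls; rewrite ffunE.
  by case: eqP => // lk; rewrite lk (negbTE ks) in ls.
rewrite (avg_flip k) expRD.
apply: (@le_trans _ _ (avg (fun w => expR A * expR ((U w) ^+ 2 / (p - 8 * A))))); last first.
  rewrite avgZ ler_wpM2l ?expR_ge0 // IH //; lra.
apply: le_avg => w.
rewrite !big_cons -/(U w) -/(U (flip k w)) U_flip ffunE eqxx.
(* Flipping the sign of [k] only changes the sign of the cross term [y], so the mean of the two
   exponentials contains the hyperbolic cosine of [y]. *)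
have -> : (a k * (-1) ^+ (w k) + U w) ^+ 2 / p =
   (A + U w ^+ 2) / p + 2 * (a k * (-1) ^+ (w k)) * U w / p.
  by rewrite sqrrD exprMn sqrr_sign mulr1 /A -mulr_natl; field; lra.
have -> : (a k * (-1) ^+ (~~ w k) + U w) ^+ 2 / p =
   (A + U w ^+ 2) / p + - (2 * (a k * (-1) ^+ (w k)) * U w / p).
  by rewrite signrN mulrN sqrrD sqrrN exprMn sqrr_sign mulr1 /A -mulr_natl; field; lra.
set y := 2 * _ * _ / p.
rewrite !expRD -mulrDr -mulrA.
apply: (@le_trans _ _ (expR ((A + U w ^+ 2) / p) * expR (2 * y ^+ 2))).
  by rewrite ler_wpM2l ?expR_ge0 ?cosh_le_exp.
rewrite -!expRD ler_expR.
have -> : 2 * y ^+ 2 = 8 * A * U w ^+ 2 / p ^+ 2.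
  by rewrite /y !exprMn sqrr_sign mulr1 /A exprVn; field; lra.
rewrite mulrDl -addrA lerD //.
  by rewrite ler_pdivrMr // ler_peMr.
set V := U w ^+ 2.
have V0 : 0 <= V by exact: sqr_ge0.
have -> : V / p + 8 * A * V / p ^+ 2 = V * ((p + 8 * A) / p ^+ 2) by field; lra.
(* The remaining inequality is [(p - 8 * A) * (p + 8 * A) <= p ^+ 2]. *)
rewrite ler_wpM2l // ler_pdivrMr ?exprn_gt0 // ler_pdivlMl // expr2; nra.
Qed.

(** The 9 is [8 * 1 + 1], the value of [p] that [avg_exp_sqr] allows for every such [a]. *)
Lemma avg_exp_signs_dot a : \sum_k a k ^+ 2 <= 1 ->
  avg (fun w => expR (signs_dot a w ^+ 2 / 9)) <= expR 1.
Proof.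
move=> a1.
apply: le_trans (_ : expR (\sum_k a k ^+ 2) <= _); last by rewrite ler_expR.
by apply: avg_exp_sqr; [exact: index_enum_uniq|lra].
Qed.

Lemma avg_sign_sign k l :
  avg (fun w => (-1) ^+ (w k) * (-1) ^+ (w l)) = (k == l)%:R :> R.
Proof.
case: eqP => [->|/eqP kl].
  under eq_avg => w do rewrite -expr2 sqrr_sign.
  by rewrite avg_cst ?card_signs.
rewrite (avg_flip k) -[RHS](@avg_cst _ {ffun K -> bool} 0) ?card_signs //.
apply: eq_avg => w; rewrite !ffunE eqxx eq_sym (negbTE kl) signrN mulNr.
by rewrite subrr mul0r.
Qed.

(** Unbiasedness of the estimator: only the diagonal terms survive averaging. *)
Lemma avg_signs_dotM a b :
  avg (fun w => signs_dot a w * signs_dot b w) = \sum_k a k * b k.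
Proof.
transitivity (avg (fun w => \sum_k \sum_l (a k * b l) * ((-1) ^+ (w k) * (-1) ^+ (w l)))).
  apply: eq_avg => w; rewrite /signs_dot big_distrlr /=.
  by apply: eq_bigr => k _; apply: eq_bigr => l _; ring.
rewrite avg_sum; apply: eq_bigr => k _; rewrite avg_sum (bigD1 k) //= avgZ.
rewrite avg_sign_sign eqxx mulr1 big1 ?addr0 // => l lk.
by rewrite avgZ avg_sign_sign eq_sym (negbTE lk) mulr0.
Qed.

Definition chaos_cst : R := 27 ^+ 2 * expR 1.

(** With [t = (u ^+ 2 + v ^+ 2) / 2], the square of [u * v] costs [27 ^+ 2 * expR (2 * t / 27)] and
    the exponential costs [expR (t / 27)]. Together they give [expR (t / 9)], which the
    arithmetic-geometric mean inequality splits into the two integrable exponentials. *)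
Lemma exp_chaos_le (s u v : R) : `|s| <= 1 / 27 ->
  expR (s * (u * v)) <= 1 + s * (u * v) +
     s ^+ 2 * (27 ^+ 2 * ((expR (u ^+ 2 / 9) + expR (v ^+ 2 / 9)) / 2)).
Proof.
move=> hs; apply: (le_trans (expR_le_quad _)); rewrite lerD2l exprMn.
rewrite -mulrA ler_wpM2l ?sqr_ge0 //.
pose t := (u ^+ 2 + v ^+ 2) / 2.
have t0 : 0 <= t by rewrite divr_ge0 // addr_ge0 ?sqr_ge0.
have uvt : `|u * v| <= t.
  rewrite /t normrM ler_pdivlMr // -(real_normK (num_real u)) -(real_normK (num_real v)).
  have := sqr_ge0 (`|u| - `|v|); rewrite sqrrB -mulr_natl; lra.
have uv2 : (u * v) ^+ 2 <= t ^+ 2.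
  by rewrite -(real_normK (num_real (u * v))) lerXn2r ?nnegrE.
have t2 : t ^+ 2 <= 27 ^+ 2 * expR (2 * t / 27).
  pose x := t / 27; have -> : t = 27 * x by rewrite /x; field.
  have x0 : 0 <= x by rewrite divr_ge0.
  rewrite exprMn ler_wpM2l // (_ : 2 * _ / _ = x + x); last by field.
  rewrite expRD -expr2 lerXn2r ?nnegrE ?expR_ge0 //.
  by have := expR_ge1Dx x; lra.
have ee : expR `|s * (u * v)| <= expR (t / 27).
  by rewrite ler_expR normrM (_ : t / 27 = 1 / 27 * t) ?ler_pM //; field.
apply: (@le_trans _ _ ((27 ^+ 2 * expR (2 * t / 27)) * expR (t / 27))).
  by rewrite ler_pM ?sqr_ge0 ?expR_ge0 ?(le_trans uv2).
rewrite -mulrA ler_wpM2l // -expRD.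
have -> : 2 * t / 27 + t / 27 = u ^+ 2 / 18 + v ^+ 2 / 18 by rewrite /t; field.
rewrite expRD.
have -> : u ^+ 2 / 9 = u ^+ 2 / 18 + u ^+ 2 / 18 by field.
have -> : v ^+ 2 / 9 = v ^+ 2 / 18 + v ^+ 2 / 18 by field.
rewrite 2!expRD.
have := sqr_ge0 (expR (u ^+ 2 / 18) - expR (v ^+ 2 / 18)).
rewrite sqrrB -mulr_natl !expr2; lra.
Qed.

(** After averaging [exp_chaos_le], the linear term [s * mu] is absorbed by [1 + z <= expR z] and
    cancels against the centring factor. *)
Lemma avg_exp_chaos a b (s : R) :
  \sum_k a k ^+ 2 <= 1 -> \sum_k b k ^+ 2 <= 1 -> `|s| <= 1 / 27 ->
  avg (fun w => expR (s * (signs_dot a w * signs_dot b w - \sum_k a k * b k)))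
    <= expR (chaos_cst * s ^+ 2).
Proof.
move=> a1 b1 hs; set mu := \sum_k a k * b k.
under eq_avg => w do rewrite mulrBr addrC expRD.
rewrite avgZ.
apply: (@le_trans _ _ (expR (- (s * mu)) * (1 + s * mu + s ^+ 2 * chaos_cst))).
  rewrite ler_wpM2l ?expR_ge0 //.
  apply: le_trans (le_avg (fun w => exp_chaos_le _ _ hs)) _.
  rewrite !avgD avg_cst ?card_signs // avgZ avg_signs_dotM !avgZ -/mu lerD2l.
  rewrite ler_wpM2l ?sqr_ge0 // /chaos_cst ler_wpM2l //.
  under eq_avg => w do rewrite mulrC.
  rewrite avgZ avgD.
  have := avg_exp_signs_dot a1; have := avg_exp_signs_dot b1; lra.
rewrite -ler_pdivlMl ?expR_gt0 // -expRN -expRD.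
apply: le_trans (expR_ge1Dx _); rewrite opprK mulrC; lra.
Qed.

End Rademacher.

(** * Suprema of the sampling error by chaining *)

Lemma sqr_sum_le (R : realType) (I : Type) (s : seq I) (P : pred I) (a b : I -> R) :
  (\sum_(i <- s | P i) a i * b i) ^+ 2 <=
  (\sum_(i <- s | P i) a i ^+ 2) * (\sum_(i <- s | P i) b i ^+ 2).
Proof.
set A := \sum_(i <- s | P i) a i ^+ 2; set B := \sum_(i <- s | P i) b i ^+ 2.
set C := \sum_(i <- s | P i) a i * b i.
have A0 : 0 <= A by apply: sumr_ge0 => i _; exact: sqr_ge0.
have quad (t : R) : 0 <= A * t ^+ 2 - 2 * t * C + B.
  rewrite (_ : _ + B = \sum_(i <- s | P i) (a i * t - b i) ^+ 2).
    by apply: sumr_ge0 => i _; exact: sqr_ge0.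
  rewrite /A /B /C mulr_suml mulr_sumr -sumrB -big_split /=.
  by apply: eq_bigr => i _; ring.
move: A0; rewrite le_eqVlt => /predU1P[A0|A0].
  have [->|C0] := eqVneq C 0; first by rewrite expr0n /= -A0 mul0r.
  (* With [A = 0] and [C] nonzero, this argument gives the quadratic the value -1. *)
  have := quad ((B + 1) / (2 * C)); rewrite -A0 mul0r.
  have -> : 2 * ((B + 1) / (2 * C)) * C = B + 1 by field.
  lra.
have := quad (C / A).
have -> : A * (C / A) ^+ 2 - 2 * (C / A) * C + B = (A * B - C ^+ 2) / A.
  by field; rewrite gt_eqF.
by rewrite pmulr_lge0 ?invr_gt0 // subr_ge0.
Qed.

(** With [k] the expectation of [expR u], this replaces Jensen's inequality for [ln]. *)
Lemma ln_le_exp (R : realType) (u k : R) : 0 < k -> u <= ln k - 1 + expR u / k.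
Proof.
move=> k0; have := expR_ge1Dx (u - ln k).
rewrite expRD expRN lnK ?posrE //; lra.
Qed.

Section Sampling.
Variables (R : realType) (K : finType) (n : nat).
Local Notation Omega := {ffun 'I_n -> {ffun K -> bool}}.
Implicit Types (a b : K -> R) (w : Omega).

(** For [b] the basis values at [x], this is [n] times the error of the estimator at [x] within the
    box. *)
Definition chaos a b w : R :=
  \sum_i (signs_dot a (w i) * signs_dot b (w i) - \sum_k a k * b k).

Lemma signs_dotD a b c (e : {ffun K -> bool}) : (forall k, a k = b k + c k) ->
  signs_dot a e = signs_dot b e + signs_dot c e.
Proof.
by move=> abc; rewrite /signs_dot -big_split; apply: eq_bigr => k _; rewrite abc mulrDl.
Qed.

Lemma chaosD a b c d w : (forall k, b k = c k + d k) ->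
  chaos a b w = chaos a c w + chaos a d w.
Proof.
move=> bcd; rewrite /chaos -big_split; apply: eq_bigr => i _ /=.
have -> : \sum_k a k * b k = \sum_k a k * c k + \sum_k a k * d k.
  by rewrite -big_split; apply: eq_bigr => k _; rewrite bcd mulrDr.
by rewrite (signs_dotD _ bcd) mulrDr opprD addrACA.
Qed.

Lemma signs_dot_sqr a (e : {ffun K -> bool}) :
  signs_dot a e ^+ 2 <= #|K|%:R * \sum_k a k ^+ 2.
Proof.
apply: le_trans (sqr_sum_le _ _ _ _) _; rewrite mulrC ler_wpM2r //.
  by apply: sumr_ge0 => i _; exact: sqr_ge0.
by under eq_bigr => k _ do rewrite sqrr_sign; rewrite sumr_const.
Qed.

(** A deterministic bound by Cauchy-Schwarz. Its factor [#|K|] is harmless because it is applied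
    only below the finest grid, where [beta] is as small as desired. *)
Lemma chaos_le a b w (beta : R) : 0 <= beta ->
  \sum_k a k ^+ 2 <= 1 -> \sum_k b k ^+ 2 <= beta ^+ 2 ->
  `|chaos a b w| <= n%:R * ((#|K|%:R + 1) * beta).
Proof.
move=> beta0 a1 b1; apply: le_trans (ler_norm_sum _ _ _) _.
rewrite mulr_natl -[X in _ *+ X](card_ord n) -sumr_const.
have a0 : 0 <= \sum_k a k ^+ 2 by apply: sumr_ge0 => i _; exact: sqr_ge0.
have b0 : 0 <= \sum_k b k ^+ 2 by apply: sumr_ge0 => i _; exact: sqr_ge0.
apply: ler_sum => i _; apply: le_trans (ler_normB _ _) _.
rewrite mulrDl mul1r; apply: lerD.
  rewrite -(@ler_pXn2r _ 2) ?nnegrE ?mulr_ge0 // real_normK ?num_real //.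
  rewrite !exprMn (_ : #|K|%:R ^+ 2 * beta ^+ 2 = (#|K|%:R * 1) * (#|K|%:R * beta ^+ 2));
    last by ring.
  apply: ler_pM; rewrite ?sqr_ge0 //.
    by apply: le_trans (signs_dot_sqr _ _) _; rewrite ler_wpM2l.
  by apply: le_trans (signs_dot_sqr _ _) _; rewrite ler_wpM2l.
rewrite -(@ler_pXn2r _ 2) ?nnegrE // real_normK ?num_real //.
apply: le_trans (sqr_sum_le _ _ _ _) _; rewrite -[leRHS]mul1r.
by apply: ler_pM.
Qed.

Lemma avg_exp_chaosn a b (s delta : R) : 0 < delta -> `|s| <= 1 / 27 ->
  \sum_k a k ^+ 2 <= 1 -> \sum_k b k ^+ 2 <= delta ^+ 2 ->
  avg (fun w => expR (s / delta * chaos a b w)) <= expR (n%:R * (chaos_cst R * s ^+ 2)).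
Proof.
move=> d0 s1 a1 bd; pose b' k := b k / delta.
have b'1 : \sum_k b' k ^+ 2 <= 1.
  rewrite /b'; under eq_bigr => k _ do rewrite exprMn.
  by rewrite -mulr_suml exprVn ler_pdivrMr ?exprn_gt0 // mul1r.
have -> : avg (fun w => expR (s / delta * chaos a b w)) =
  avg (fun w : Omega => \prod_i
    expR (s * (signs_dot a (w i) * signs_dot b' (w i) - \sum_k a k * b' k))).
  apply: eq_avg => w; rewrite -expR_sum /chaos mulr_sumr; congr expR.
  apply: eq_bigr => i _.
  have -> : signs_dot b' (w i) = signs_dot b (w i) / delta.
    by rewrite /signs_dot mulr_suml; apply: eq_bigr => k _; rewrite mulrAC.
  have -> : \sum_k a k * b' k = (\sum_k a k * b k) / delta.
    by rewrite mulr_suml; apply: eq_bigr => k _; rewrite mulrA.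
  by field; rewrite gt_eqF.
rewrite (avg_prod n (fun e => expR (s * (signs_dot a e * signs_dot b' e - _)))).
rewrite expRM_natl lerXn2r ?nnegrE ?expR_ge0 //.
  by rewrite mulr_ge0 ?invr_ge0 // sumr_ge0 // => ? _; exact: expR_ge0.
exact: avg_exp_chaos.
Qed.

Lemma card_samples : (0 < #|Omega|)%N.
Proof. by rewrite card_ffun expn_gt0 card_signs. Qed.

(** [B] is the bound of [ln_le_exp] for [u = s / delta * `|chaos a (b t) w|], with
[expR u] enlarged to a sum over all [t] and both signs. *)
Lemma chaos_max a (T : finType) (b : T -> K -> R) (s delta : R) :
  (0 < #|T|)%N -> 0 < delta -> 0 < s <= 1 / 27 ->
  \sum_k a k ^+ 2 <= 1 -> (forall t, \sum_k b t k ^+ 2 <= delta ^+ 2) ->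
  exists B : Omega -> R,
    (forall w t, `|chaos a (b t) w| <= B w) /\
    avg B <= delta / s * (ln (2 * #|T|%:R) + n%:R * (chaos_cst R * s ^+ 2)).
Proof.
move=> T0 d0 /andP[s0 s1] a1 bd.
set q := n%:R * _; have T0' : 0 < #|T|%:R :> R by rewrite ltr0n.
(* Bounds the average of [\sum_t F t]: two signs, [#|T|] indices, and [expR q] for each exponential.
   The last term of [ln_le_exp] then averages to at most 1 and cancels the -1. *)
pose k := 2 * #|T|%:R * expR q.
have k0 : 0 < k by rewrite !mulr_gt0 ?expR_gt0.
have sd0 : 0 < s / delta by rewrite divr_gt0.
pose F t w := expR (s / delta * chaos a (b t) w) + expR (- s / delta * chaos a (b t) w).
exists (fun w => delta / s * (ln k - 1 + \sum_t F t w / k)); split.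
  move=> w t.
  have -> : `|chaos a (b t) w| = delta / s * (s / delta * `|chaos a (b t) w|).
    by field; rewrite !gt_eqF.
  rewrite ler_wpM2l //; first by rewrite divr_ge0 // ltW.
  apply: le_trans (ln_le_exp _ k0) _; rewrite lerD2l (bigD1 t) //=.
  rewrite -[leLHS]addr0 lerD //; last first.
    by apply: sumr_ge0 => i _; rewrite divr_ge0 ?addr_ge0 ?expR_ge0 // ltW.
  rewrite ler_pM2r ?invr_gt0 // /F mulNr.
  case: (lerP 0 (chaos a (b t) w)) => h.
    by rewrite ger0_norm // lerDl expR_ge0.
  by rewrite ltr0_norm // mulNr mulrN lerDr expR_ge0.
rewrite avgZ ler_wpM2l //; first by rewrite divr_ge0 // ltW.
rewrite avgD avg_cst ?card_samples // avg_sum.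
have kE : ln k = ln (2 * #|T|%:R) + q by rewrite [LHS]lnM ?posrE ?expR_gt0 ?mulr_gt0 // expRK.
rewrite kE -[leRHS]addr0 -[X in _ <= _ + X](addNr 1) addrA lerD2l.
apply: (@le_trans _ _ (\sum_(t : T) (2 * expR q) / k)).
  apply: ler_sum => t _; under eq_avg => w do rewrite mulrC.
  rewrite avgZ mulrC ler_pM2r ?invr_gt0 // avgD.
  have h1 : avg (fun w => expR (s / delta * chaos a (b t) w)) <= expR q.
    by apply: avg_exp_chaosn => //; rewrite gtr0_norm.
  have h2 : avg (fun w => expR (- s / delta * chaos a (b t) w)) <= expR q.
    by rewrite /q -[s]opprK sqrrN opprK; apply: avg_exp_chaosn => //; rewrite normrN gtr0_norm.
  lra.
rewrite sumr_const -mulr_natl /k.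
by rewrite le_eqVlt; apply/orP; left; apply/eqP; field; rewrite !gt_eqF ?expR_gt0.
Qed.

End Sampling.

(** Sums, over the levels, linearly growing entropy against halving radii. *)
Lemma sum_arith_geom (R : realType) (M : nat) :
  \sum_(j < M) (j.+1%:R * 2^-1 ^+ j) <= 4 :> R.
Proof.
suff -> : \sum_(j < M) (j.+1%:R * 2^-1 ^+ j) = 4 - (M.+2)%:R * 2 * 2^-1 ^+ M :> R.
  by rewrite gerBl !mulr_ge0 ?exprn_ge0 // invr_ge0.
elim: M => [|M IH]; first by rewrite big_ord0 expr0; ring.
by rewrite big_ord_recr /= IH exprS -(natr1 M.+2) -(natr1 M.+1); field.
Qed.

(** * Chaining along grids of halving radius *)

Section Chaining.
Variables (R : realType) (K : finType) (n : nat).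
Local Notation Omega := {ffun 'I_n -> {ffun K -> bool}}.
Variables (a : K -> R) (X : Type) (phi : X -> K -> R).
Variables (T : nat -> finType) (g : forall j, T j -> X).
Variables (rho c L : R).
Hypotheses (n0 : (0 < n)%N) (Ln : 0 < L <= n%:R).
Hypotheses (a1 : \sum_k a k ^+ 2 <= 1) (phi1 : forall x, \sum_k phi x k ^+ 2 <= 1).
Hypothesis rho0 : 0 < rho.
Hypothesis T0 : forall j, (0 < #|T j|)%N.
Hypothesis cover : forall j x, exists t : T j,
  \sum_k (phi x k - phi (g t) k) ^+ 2 <= (rho * 2^-1 ^+ j) ^+ 2.
Hypothesis entropy : forall j, ln (2 * #|T j|%:R) <= c * L * j.+1%:R.

(** One Laplace parameter for all levels: it makes the variance term of
[chaos_max] equal to [expR 1 * L], of the order of the entropy at level 0. *)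
Definition chain_step : R := Num.sqrt (L / n%:R) / 27.

Let L0 : 0 < L. Proof. by case/andP: Ln. Qed.

Let n0' : 0 < n%:R :> R. Proof. by rewrite ltr0n. Qed.

Let s_gt0 : 0 < chain_step.
Proof. by rewrite /chain_step divr_gt0 // sqrtr_gt0 divr_gt0. Qed.

Let s_le : chain_step <= 1 / 27.
Proof.
rewrite /chain_step ler_wpM2r // -[leRHS]sqrtr1 ler_wsqrtr // ler_pdivrMr // mul1r.
by case/andP: Ln.
Qed.

Let q_eq : n%:R * (chaos_cst R * chain_step ^+ 2) = expR 1 * L.
Proof.
rewrite /chain_step /chaos_cst exprMn sqr_sqrtr; last by rewrite divr_ge0 // ltW.
by field; rewrite gt_eqF.
Qed.

Let cL0 : 0 <= c * L.
Proof.
rewrite -[c * L]mulr1; apply: le_trans (entropy 0); apply: ln_ge0.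
by rewrite (le_trans (_ : 1 <= 2 * 1)) ?ler_wpM2l ?ler1n //; lra.
Qed.

Let level_cost j : ln (2 * #|T j|%:R) + n%:R * (chaos_cst R * chain_step ^+ 2)
  <= (c + expR 1) * L * j.+1%:R.
Proof.
rewrite q_eq (_ : _ * L * _ = c * L * j.+1%:R + expR 1 * L * j.+1%:R); last by ring.
rewrite lerD // ler_peMr ?ler1n //.
by rewrite mulr_ge0 ?expR_ge0 // ltW.
Qed.

(** Induction on the level: each point of grid [M.+1] is linked to one nearby point of grid [M], so
    a level has only [#|T M.+1|] increments, all of size at most [rho * 2^-1 ^+ M], and [chaos_max]
    controls them jointly. *)
Lemma chaining_grid (M : nat) : exists B : Omega -> R,
  (forall w (t : T M), `|chaos a (phi (g t)) w| <= B w) /\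
  avg B <= (c + expR 1) * L / chain_step *
           (1 + 2 * rho * \sum_(j < M) (j.+1%:R * 2^-1 ^+ j)).
Proof.
have hs : 0 < chain_step <= 1 / 27 by rewrite s_gt0 s_le.
elim: M => [|M [B [hB avgB]]].
  have [|B [hB avgB]] := @chaos_max R K n a (T 0) (fun t => phi (g t)) chain_step 1
    (T0 0) ltr01 hs a1; first by move=> t; rewrite expr1n.
  exists B; split => //; apply: (le_trans avgB).
  rewrite big_ord0 mulr0 addr0 mulr1 mul1r mulrC ler_wpM2r ?invr_ge0 ?(ltW s_gt0) //.
  by have := level_cost 0; rewrite mulr1.
pose near (t : T M.+1) := sval (cid (cover M (g t))).
have nearP (t : T M.+1) := svalP (cid (cover M (g t))).
have d0 : 0 < rho * 2^-1 ^+ M by rewrite mulr_gt0 // exprn_gt0 // invr_gt0.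
have [B' [hB' avgB']] := @chaos_max R K n a (T M.+1)
  (fun t k => phi (g t) k - phi (g (near t)) k) chain_step _ (T0 M.+1) d0 hs a1 nearP.
exists (fun w => B w + B' w); split.
  move=> w t; rewrite (@chaosD _ _ _ _ _ (phi (g (near t)))
    (fun k => phi (g t) k - phi (g (near t)) k)); last by move=> k; ring.
  by apply: le_trans (ler_normD _ _) _; rewrite lerD.
rewrite avgD big_ord_recr /= [2 * rho * _]mulrDr addrA mulrDr lerD //.
apply: (le_trans avgB').
apply: (@le_trans _ _ (rho * 2^-1 ^+ M / chain_step * ((c + expR 1) * L * M.+2%:R))).
  by rewrite ler_wpM2l // divr_ge0 // ltW.
(* The entropy factor [M.+2] of the finer grid is at most [2 * M.+1], whence the 2 in front of
   [rho]. *)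
rewrite (_ : _ * (2 * rho * _) = rho * 2^-1 ^+ M / chain_step *
  ((c + expR 1) * L * (2 * M.+1%:R))); last by ring.
rewrite ler_wpM2l ?divr_ge0 ?(ltW d0) ?(ltW s_gt0) // ler_wpM2l //.
  by rewrite mulrDl addr_ge0 // mulr_ge0 ?expR_ge0 // ltW.
by rewrite -natrM ler_nat mul2n -addnn ltnS leq_addl.
Qed.

(** The 27 is the denominator in [chain_step]; [8 * rho] is [2 * rho] times the bound 4 of
    [sum_arith_geom]. *)
Definition chain_cst : R := 27 * (c + expR 1) * (1 + 8 * rho).

Lemma chaining (eta : R) : 0 < eta -> exists B : Omega -> R,
  (forall w x, `|n%:R^-1 * chaos a (phi x) w| <= B w) /\
  avg B <= chain_cst * Num.sqrt (L / n%:R) + eta.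
Proof.
move=> eta0.
have Kp : 0 < (#|K|%:R + 1) * rho :> R by rewrite mulr_gt0 // ltr_wpDl.
(* The depth [M] depends on [#|K|], but the bound of [chaining_grid] is uniform in [M]; the last
   link then costs at most [eta] by [chaos_le]. *)
have [M hM] : exists M : nat, (#|K|%:R + 1) * rho * 2^-1 ^+ M <= eta.
  have : (#|K|%:R + 1) * rho / eta < 2 ^+ (Num.truncn ((#|K|%:R + 1) * rho / eta)).+1.
    apply: lt_trans (_ : (Num.truncn ((#|K|%:R + 1) * rho / eta)).+1%:R < _).
      by apply: truncnS_gt.
    by rewrite -natrX ltr_nat ltn_expl.
  set M := (Num.truncn _).+1 => h; exists M.
  by rewrite exprVn ler_pdivrMr ?exprn_gt0 // -ler_pdivrMl // mulrC ltW.
have [B [hB avgB]] := chaining_grid M.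
exists (fun w => n%:R^-1 * B w + eta); split.
  move=> w x; have [t ht] := cover M x.
  rewrite (@chaosD _ _ _ _ _ (phi (g t)) (fun k => phi x k - phi (g t) k)); last by move=> k; ring.
  rewrite mulrDr; apply: le_trans (ler_normD _ _) _.
  rewrite !normrM [`|n%:R^-1|]ger0_norm ?invr_ge0 // lerD // ?ler_wpM2l ?invr_ge0 //.
  rewrite ler_pdivrMl //.
  apply: le_trans (chaos_le _ _ _ ht) _ => //; last first.
    by rewrite ler_wpM2l // mulrA.
  by rewrite mulr_ge0 ?exprn_ge0 ?invr_ge0 // ltW.
rewrite avgD avg_cst ?card_samples // lerD2r avgZ ler_pdivrMl //.
apply: (le_trans avgB).
apply: (@le_trans _ _ ((c + expR 1) * L / chain_step * (1 + 8 * rho))).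
  rewrite ler_wpM2l //.
    by rewrite divr_ge0 ?(ltW s_gt0) // mulrDl addr_ge0 // mulr_ge0 ?expR_ge0 // ltW.
  have : rho * _ <= rho * 4 := ler_wpM2l (ltW rho0) (sum_arith_geom R M); lra.
rewrite le_eqVlt; apply/orP; left; apply/eqP.
rewrite /chain_cst /chain_step.
set q := Num.sqrt _.
have q0 : 0 < q by rewrite sqrtr_gt0 divr_gt0.
have -> : L = n%:R * q ^+ 2 by rewrite sqr_sqrtr ?divr_ge0 1?ltW // mulrC divfK ?gt_eqF.
by field; rewrite gt_eqF.
Qed.

End Chaining.

(** * The Korobov kernel on boxes of frequencies *)

Section RealLemmas.
Variable R : realType.
Implicit Types (x s : R).

Lemma one_sub_cos_le x : 1 - cos x <= `|x|.
Proof.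
wlog x0 : x / 0 <= x.
  move=> h; case: (lerP 0 x) => [x0|x0].
    by have := h x x0; rewrite ger0_norm.
  have := h (- x); rewrite cosN normrN ltr0_norm //; apply; rewrite oppr_ge0; exact: ltW.
rewrite ger0_norm //; move: x0; rewrite le_eqVlt => /predU1P[<-|x0].
  by rewrite cos0 subrr.
have [c _] := @MVT R cos (fun y => - sin y) 0 x x0 (fun y _ => is_derive_cos y)
  (continuous_subspaceT (@continuous_cos R)).
rewrite cos0 subr0 => h.
have := sin_le1 c; nra.
Qed.

(** Comparison of a series term with the integral over [[x - 1, x]], obtained from
    [ln (x - 1) <= ln x - x^-1] and [1 + u <= expR u] with [u = (s - 1) / x]. *)
Lemma powR_telescope x s : 1 < s -> 1 < x ->
  (s - 1) * x `^ (- s) <= (x - 1) `^ (- (s - 1)) - x `^ (- (s - 1)).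
Proof.
move=> s1 x1; have x0 : 0 < x by lra.
have s0 : 0 < s - 1 by lra.
have -> : x `^ (- s) = x `^ (- (s - 1)) / x.
  rewrite -[X in _ / X](powRr1 (ltW x0)) -powRB; last by rewrite (gt_eqF x0) implybT.
  by congr (_ `^ _); ring.
rewrite lerBrDl (_ : _ + _ = (1 + (s - 1) / x) * x `^ (- (s - 1))); last by ring.
rewrite /powR !gt_eqF ?subr_gt0 // !mulNr.
apply: le_trans (ler_wpM2r (expR_ge0 _) (expR_ge1Dx _)) _.
rewrite -expRD ler_expR.
have h : ln (x - 1) <= ln x - x^-1.
  have -> : x - 1 = x * (1 + - x^-1) by field; rewrite gt_eqF.
  have x1' : - 1 < - x^-1 by rewrite ltrN2 invf_lt1.
  rewrite lnM ?posrE //; first by rewrite lerD2l le_ln1Dx.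
  by lra.
have : (s - 1) * ln (x - 1) <= (s - 1) * (ln x - x^-1) by rewrite ler_pM2l.
rewrite mulrBr; lra.
Qed.

Lemma sum_powR_le s N : 1 < s ->
  \sum_(m < N) (m.+1%:R : R) `^ (- s) <= 1 + (s - 1)^-1.
Proof.
move=> s1; have s0 : 0 < s - 1 by lra.
case: N => [|N]; first by rewrite big_ord0 addr_ge0 // invr_ge0 ltW.
(* The subtracted remainder makes the induction telescope. *)
apply: (@le_trans _ _ (1 + (s - 1)^-1 - (s - 1)^-1 * (N.+1%:R : R) `^ (- (s - 1)))).
  elim: N => [|N IH]; first by rewrite big_ord1 !powR1 mulr1 addrK.
  rewrite big_ord_recr /=.
  have := @powR_telescope N.+2%:R s s1; rewrite ltr1n => /(_ isT).
  rewrite -[N.+2%:R - 1](_ : N.+1%:R = _); last by rewrite -[in RHS]natr1 addrK.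
  rewrite -ler_pdivlMl // mulrBr; lra.
by rewrite gerBl mulr_ge0 ?invr_ge0 ?powR_ge0 // ltW.
Qed.

Lemma prod_sub_le (I : Type) (s : seq I) (a b : I -> R) :
  (forall i, `|a i| <= 1) -> (forall i, `|b i| <= 1) ->
  `|\prod_(i <- s) a i - \prod_(i <- s) b i| <= \sum_(i <- s) `|a i - b i|.
Proof.
move=> a1 b1; elim: s => [|i s IH]; first by rewrite !big_nil subrr normr0.
rewrite !big_cons.
set A := \prod_(j <- s) a j in IH *; set B := \prod_(j <- s) b j in IH *.
have B1 : `|B| <= 1.
  rewrite normr_prod -[leRHS](@big1_eq R 1 *%R _ s xpredT).
  by apply: ler_prod => j _; rewrite normr_ge0 b1.
have -> : a i * A - b i * B = (a i - b i) * B + a i * (A - B) by ring.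
apply: le_trans (ler_normD _ _) _; rewrite !normrM lerD //.
  by rewrite ler_piMr.
by apply: le_trans IH; rewrite ler_piMl.
Qed.

(** Interpolates between the bound 2 and the Lipschitz bound. For [k > T ^+ p] the right-hand side
    exceeds 2; otherwise [u = k / T ^+ p] is at most 1, hence at most its [p]-th root. *)
Lemma one_sub_cos_holder (p k : nat) (t T : R) : (0 < p)%N -> (0 < k)%N -> 1 <= T ->
  `|t| <= T ^- p ->
  1 - cos (2 * pi * k%:R * t) <= 2 * pi * ((k%:R : R) `^ (p%:R^-1) / T).
Proof.
move=> p0 k0 T1 tT; have T0 : 0 < T by lra.
have pi1 : 1 <= pi :> R by have := @pi_ge2 R; lra.
have p0' : 0 < p%:R :> R by rewrite ltr0n.
have k0' : 0 < k%:R :> R by rewrite ltr0n.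
have [kT|kT] := lerP (k%:R : R) (T ^+ p); last first.
  apply: (@le_trans _ _ 2); first by have := cos_geN1 (2 * pi * k%:R * t); lra.
  rewrite -[leLHS]mulr1; apply: ler_pM => //; first by rewrite ler_peMr.
  rewrite ler_pdivlMr // mul1r.
  have -> : T = (T ^+ p) `^ (p%:R^-1).
    by rewrite -powR_mulrn ?(ltW T0) // -powRrM divff ?gt_eqF // powRr1 // ltW.
  by rewrite ge0_ler_powR ?invr_ge0 ?nnegrE ?exprn_ge0 ?ltW.
apply: le_trans (one_sub_cos_le _) _.
have -> : `|2 * pi * k%:R * t| = 2 * pi * (k%:R * `|t|).
  by rewrite !normrM !normr_nat [`|pi|]ger0_norm ?pi_ge0 // !mulrA.
have pi20 : 0 <= 2 * pi :> R by rewrite mulr_ge0 ?pi_ge0.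
rewrite ler_wpM2l //.
apply: (le_trans (ler_wpM2l (ltW k0') tT)).
have -> : k%:R `^ p%:R^-1 / T = (k%:R / T ^+ p) `^ (p%:R^-1).
  rewrite powRM ?invr_ge0 ?exprn_ge0 ?ltW // -exprVn -powR_mulrn ?invr_ge0 ?ltW //.
  by rewrite -powRrM divff ?gt_eqF // powRr1 // invr_ge0 ltW.
apply: ger1_powR.
  by rewrite divr_gt0 ?exprn_gt0 //= ler_pdivrMr ?exprn_gt0 // mul1r.
by rewrite invf_le1 // ler1n.
Qed.

End RealLemmas.

(** * Truncated kernels and grids on the torus *)

Section Box.
Variables (R : realType) (r beta0 beta1 : R).
Hypotheses (b0 : 0 < beta0) (b1 : 0 < beta1).
Hypothesis norm1 : (beta0%:E + beta1%:E * riemann_zeta (2 * r))%E = 1%E.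

Definition weight (m : nat) : R := beta1 * (m.+1%:R : R) `^ (- (2 * r)).

Lemma weight_ge0 m : 0 <= weight m.
Proof. by rewrite mulr_ge0 ?powR_ge0 // ltW. Qed.

Lemma sum_weight_le1 N : beta0 + \sum_(m < N) weight m <= 1.
Proof.
rewrite -lee_fin -norm1 EFinD leeD2l // -mulr_sumr EFinM lee_pmul2l //.
rewrite /riemann_zeta.
apply: le_trans (nneseries_lim_ge (m := 1) (P := xpredT) N.+1 _); last first.
  by move=> n _ _; rewrite lee_fin powR_ge0.
by rewrite big_add1 /= big_mkord sumEFin.
Qed.

(** The truncated univariate reproducing kernel at [t = x - y]; sine and cosine of a frequency share
    one weight, which makes it translation invariant. *)
Definition kernel1 N (t : R) : R :=
  beta0 + \sum_(m < N) weight m * cos (2 * pi * m.+1%:R * t).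

Lemma kernel1_le1 N t : `|kernel1 N t| <= 1.
Proof.
apply: le_trans (sum_weight_le1 N); apply: le_trans (ler_normD _ _) _.
rewrite gtr0_norm // lerD2l; apply: le_trans (ler_norm_sum _ _ _) _.
apply: ler_sum => m _; rewrite normrM ger0_norm ?weight_ge0 //.
by rewrite ler_piMr ?weight_ge0 // cos_max.
Qed.

(** [inl n] stands for the frequency [n] (cosines) and [inr m] for [- m.+1] (sines). *)
Definition freq_index N := ('I_N.+1 + 'I_N)%type.

Definition freq N (j : freq_index N) : int :=
  match j with inl n => Posz n | inr m => Negz m end.

Lemma freq_inj N : injective (@freq N).
Proof.
by move=> [n|n] [m|m] //= [nm]; congr (_ _); apply: val_inj.
Qed.

Lemma freq_surj N (z : int) : (absz z <= N)%N -> exists j : freq_index N, freq j = z.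
Proof.
case: z => n /= h; first by exists (inl (Ordinal (h : (n < N.+1)%N))).
by exists (inr (Ordinal h)).
Qed.

Lemma psi1_kernel N x y :
  \sum_(j : freq_index N) psi1 r beta0 beta1 (freq j) x * psi1 r beta0 beta1 (freq j) y
  = kernel1 N (x - y).
Proof.
rewrite big_sumType big_ord_recl /= -expr2 sqr_sqrtr ?(ltW b0) // -addrA.
congr (_ + _); rewrite -big_split; apply: eq_bigr => m _ /=.
rewrite [2 * pi * _ * (x - y)]mulrBr cosB /weight.
rewrite -[in RHS](sqr_sqrtr (ltW b1)) -[- (2 * r)](_ : - r * 2%:R = _); last by ring.
by rewrite powRrM powR_mulrn ?powR_ge0 // /bump /= add1n; ring.
Qed.

Variable d : nat.
Hypothesis d0 : (0 < d)%N.

Definition box N := {ffun 'I_d -> freq_index N}.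

Definition box_freq N (k : box N) : mindex d := [ffun j => freq (k j)].

Lemma box_freq_inj N : injective (@box_freq N).
Proof.
move=> k l /ffunP kl; apply/ffunP => j; apply: freq_inj.
by have := kl j; rewrite !ffunE.
Qed.

Definition box_psi N (x : Defs.point R d) (k : box N) : R := psi r beta0 beta1 (box_freq k) x.

Lemma sum_box N (F : 'I_d -> int -> R) :
  \sum_(k : box N) \prod_(j < d) F j (box_freq k j) =
  \prod_(j < d) \sum_(i : freq_index N) F j (freq i).
Proof.
rewrite (bigA_distr_bigA (fun j (i : freq_index N) => F j (freq i))).
by apply: eq_bigr => k _; apply: eq_bigr => j _; rewrite ffunE.
Qed.

Lemma box_psi_kernel N x y :
  \sum_(k : box N) box_psi x k * box_psi y k = \prod_(j < d) kernel1 N (x j - y j).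
Proof.
under [RHS]eq_bigr => j _ do rewrite -psi1_kernel.
rewrite -(sum_box _ (fun j z => psi1 r beta0 beta1 z (x j) * psi1 r beta0 beta1 z (y j))).
by apply: eq_bigr => k _; rewrite /box_psi /psi -big_split.
Qed.

Lemma box_psi_le1 N x : \sum_(k : box N) box_psi x k ^+ 2 <= 1.
Proof.
under eq_bigr => k _ do rewrite expr2.
rewrite box_psi_kernel; apply: (le_trans (ler_norm _)); rewrite normr_prod.
rewrite -[leRHS](@big1_eq R 1 *%R _ (index_enum 'I_d) xpredT).
by apply: ler_prod => j _; rewrite normr_ge0 kernel1_le1.
Qed.

(** The squared distance is twice a difference of products of kernels. Factors of modulus at most 1
    are exchanged one at a time, so the cost is additive in the coordinates. *)
Lemma box_psi_dist N x y :
  \sum_(k : box N) (box_psi x k - box_psi y k) ^+ 2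
    <= 2 * \sum_(j < d) (kernel1 N 0 - kernel1 N (x j - y j)).
Proof.
have -> : \sum_(k : box N) (box_psi x k - box_psi y k) ^+ 2 =
    2 * (\prod_(j < d) kernel1 N 0 - \prod_(j < d) kernel1 N (x j - y j)).
  transitivity (\sum_(k : box N) box_psi x k * box_psi x k +
     \sum_(k : box N) box_psi y k * box_psi y k -
     2 * \sum_(k : box N) box_psi x k * box_psi y k).
    by rewrite -big_split mulr_sumr -sumrB; apply: eq_bigr => k _ /=; ring.
  have diag (z : Defs.point R d) :
      \prod_(j < d) kernel1 N (z j - z j) = \prod_(j < d) kernel1 N 0.
    by apply: eq_bigr => j _; rewrite subrr.
  by rewrite !box_psi_kernel !diag; ring.
rewrite ler_wpM2l //; apply: le_trans (ler_norm _) _.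
apply: le_trans (prod_sub_le _ _ _) _; try by move=> *; exact: kernel1_le1.
apply: ler_sum => j _; rewrite ger0_norm // subr_ge0.
rewrite /kernel1 lerD2l; apply: ler_sum => m _.
by rewrite mulr0 cos0 ler_wpM2l ?weight_ge0 // cos_le1.
Qed.

Variable p : nat.
Hypotheses (p0 : (0 < p)%N) (p_r : 1 + p%:R^-1 < 2 * r).

Definition modulus_cst : R := 2 * pi * beta1 * (1 + (2 * r - p%:R^-1 - 1)^-1).

Lemma modulus_cst_ge0 : 0 <= modulus_cst.
Proof.
have h : 0 <= 2 * r - p%:R^-1 - 1 by rewrite -addrA -opprD subr_ge0 addrC ltW.
by rewrite /modulus_cst !mulr_ge0 ?pi_ge0 ?(ltW b1) // addr_ge0 // invr_ge0.
Qed.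

(** The Hoelder bound with exponent [1 / p] raises the weights to order [m ^ (- (2 r - 1 / p))],
    still summable by [p_r]. *)
Lemma kernel1_modulus N (T t : R) : 1 <= T -> `|t| <= T ^- p ->
  kernel1 N 0 - kernel1 N t <= modulus_cst / T.
Proof.
move=> T1 tT; have T0 : 0 < T by lra.
have s1 : 1 < 2 * r - p%:R^-1 by rewrite ltrBrDr.
apply: (@le_trans _ _ (2 * pi * beta1 / T *
    \sum_(m < N) (m.+1%:R : R) `^ (- (2 * r - p%:R^-1)))); last first.
  rewrite /modulus_cst [leRHS]mulrAC ler_wpM2l ?sum_powR_le //.
  by rewrite divr_ge0 ?(ltW T0) // !mulr_ge0 ?pi_ge0 // ltW.
rewrite /kernel1 opprD addrACA subrr add0r -sumrB mulr_sumr.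
apply: ler_sum => m _; rewrite mulr0 cos0 -mulrBr.
apply: (@le_trans _ _ (weight m * (2 * pi * ((m.+1%:R : R) `^ (p%:R^-1) / T)))).
  by rewrite ler_wpM2l ?weight_ge0 // one_sub_cos_holder.
rewrite opprB powRB; last by rewrite pnatr_eq0 implybT.
rewrite /weight powRN le_eqVlt; apply/orP; left; apply/eqP.
by field; rewrite gt_eqF ?T0 //= gt_eqF // powR_gt0.
Qed.

(** The modulus of the kernel at distance [T ^- p] is of order [T^-1]; taking
[T = d * 4 ^ j] absorbs the sum over the [d] coordinates and leaves [4 ^- j]. *)
Definition resolution j : nat := ((d * 4 ^ j) ^ p)%N.

Definition grid j := {ffun 'I_d -> 'I_(resolution j)}.

Lemma resolution_gt0 j : (0 < resolution j)%N.
Proof. by rewrite expn_gt0 muln_gt0 d0 expn_gt0. Qed.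

Definition torus_point := {x : Defs.point R d | torus x}.

Lemma grid_point_subproof j (t : grid j) :
  torus ((fun i => (t i)%:R / (resolution j)%:R) : Defs.point R d).
Proof.
move=> i; have D0 : 0 < (resolution j)%:R :> R by rewrite ltr0n resolution_gt0.
by rewrite divr_ge0 //= ltr_pdivrMr // mul1r ltr_nat.
Qed.

Definition grid_point j (t : grid j) : torus_point := exist _ _ (grid_point_subproof t).

(** Positive, and its square dominates [2 * modulus_cst] without taking a root. *)
Definition radius : R := 1 + 2 * modulus_cst.

Lemma grid_cover N j (x : torus_point) : exists t : grid j,
  \sum_(k : box N) (box_psi (sval x) k - box_psi (sval (grid_point t)) k) ^+ 2
     <= (radius * 2^-1 ^+ j) ^+ 2.
Proof.
case: x => x /= xT.
set D := resolution j; have D0 : 0 < D%:R :> R by rewrite ltr0n resolution_gt0.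
have tr i : (Num.truncn (x i * D%:R))%:R <= x i * D%:R < (Num.truncn (x i * D%:R)).+1%:R.
  by apply: truncn_itv; case/andP: (xT i) => ? _; rewrite mulr_ge0 // ltW.
have tD i : (Num.truncn (x i * D%:R) < D)%N.
  case/andP: (xT i) => x0 x1; rewrite truncn_lt_nat; last by rewrite mulr_ge0 // ltW.
  by rewrite gtr_pMl.
(* Rounding each coordinate down moves it by less than [1 / D]. *)
exists [ffun i => Ordinal (tD i)].
have d0' : 0 < d%:R :> R by rewrite ltr0n.
have T1 : 1 <= d%:R * 4 ^+ j :> R.
  by rewrite -natrX -natrM ler1n muln_gt0 d0 expn_gt0.
apply: le_trans (box_psi_dist _ _ _) _.
apply: (@le_trans _ _ (2 * \sum_(i < d) modulus_cst / (d%:R * 4 ^+ j))).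
  rewrite ler_wpM2l //; apply: ler_sum => i _; apply: kernel1_modulus => //=.
  rewrite ffunE /=.
  have -> : (d%:R * 4 ^+ j) ^- p = D%:R^-1 :> R by rewrite /D /resolution natrX natrM natrX.
  have /andP[h1 h2] := tr i.
  have h : 0 <= x i - (Num.truncn (x i * D%:R))%:R / D%:R.
    by rewrite subr_ge0 ler_pdivrMr.
  rewrite ger0_norm // lerBlDl -[X in _ <= _ + X]mul1r -mulrDl natr1 ler_pdivlMr //; exact: ltW.
rewrite sumr_const card_ord -[_ *+ d]mulr_natl exprMn -exprM mulnC exprM.
rewrite (_ : 2 * _ = 2 * modulus_cst * (4 ^+ j)^-1); last first.
  by field; rewrite !gt_eqF ?exprn_gt0.
have -> : (2^-1 ^+ 2) ^+ j = (4 ^+ j)^-1 :> R.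
  by rewrite -[RHS]exprVn; congr (_ ^+ j); field.
rewrite ler_wpM2r ?invr_ge0 ?exprn_ge0 // /radius expr2.
by have := modulus_cst_ge0; nra.
Qed.

Definition dlogd : R := d%:R * (1 + ln d%:R).

Lemma dlogd_ge1 : 1 <= dlogd.
Proof.
have h : 1 <= d%:R :> R by rewrite ler1n.
by rewrite -[1]mulr1 ler_pM // lerDl ln_ge0.
Qed.

(** The grid has [(d * 4 ^ j) ^ (p * d)] points, so the logarithm is
    [ln 2 + p d (ln d + j ln 4)]. *)
Lemma grid_entropy j :
  ln (2 * #|grid j|%:R) <= (1 + 3 * p%:R) * dlogd * j.+1%:R :> R.
Proof.
have d1 : 1 <= d%:R :> R by rewrite ler1n.
have l0 : 0 <= ln d%:R :> R by rewrite ln_ge0.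
rewrite card_ffun !card_ord /resolution -!expnM natrX natrM natrX.
have h4 : 0 < d%:R * 4 ^+ j :> R by rewrite mulr_gt0 ?exprn_gt0 // ltr0n.
rewrite lnM ?posrE ?exprn_gt0 // lnXn // lnM ?posrE ?exprn_gt0 ?ltr0n // lnXn //.
have ln2 : ln 2 <= 1 :> R by have := @le_ln1Dx R 1; rewrite (_ : 1 + 1 = 2); [apply; lra|ring].
have ln4 : ln 4 <= 3 :> R by have := @le_ln1Dx R 3; rewrite (_ : 1 + 3 = 4); [apply; lra|ring].
rewrite -[_ *+ (p * d)]mulr_natl -[_ *+ j]mulr_natl natrM.
have := dlogd_ge1; rewrite /dlogd.
have p1 : 1 <= p%:R :> R by rewrite ler1n.
have j0 : 0 <= j%:R :> R by [].
rewrite -natr1.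
set D := d%:R in d1 l0 *; set P := p%:R in p1 *; set J := j%:R in j0 *.
set l := ln D in l0 *.
move=> L1.
have h1 : P * D * (J * ln 4) <= P * D * (J * 3).
  by rewrite !ler_wpM2l // mulr_ge0 //; lra.
have h2 : P * D * (l + J * 3) <= 3 * P * (D * (1 + l)) * (J + 1).
  have PD : 0 <= P * D by rewrite mulr_ge0 //; lra.
  rewrite (_ : 3 * P * _ * _ = P * D * (3 * (1 + l) * (J + 1))); last by ring.
  by rewrite ler_wpM2l //; nra.
have h3 : D * (1 + l) <= D * (1 + l) * (J + 1).
  rewrite ler_peMr; lra.
rewrite !mulrDl mul1r !mulrDr in h1 h2 h3 L1 *; lra.
Qed.

(** Independent of [d] and of the box size [N]; this is what makes the final constant uniform in the
    dimension. *)
Definition sampling_cst : R := chain_cst radius (1 + 3 * p%:R).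

Lemma box_sampling N n (a : box N -> R) (eta : R) :
  dlogd <= n%:R -> \sum_k a k ^+ 2 <= 1 -> 0 < eta ->
  exists B : {ffun 'I_n -> {ffun box N -> bool}} -> R,
    (forall w (x : Defs.point R d), torus x -> `|n%:R^-1 * chaos a (box_psi x) w| <= B w) /\
    avg B <= sampling_cst * Num.sqrt (dlogd / n%:R) + eta.
Proof.
move=> Ln a1 eta0; have L1 := dlogd_ge1.
have n0 : (0 < n)%N by rewrite -(ltr0n R); lra.
have [||||||B [hB avgB]] := @chaining R (box N) n a torus_point
  (fun x => box_psi (sval x)) grid grid_point radius (1 + 3 * p%:R) dlogd
  n0 _ a1 _ _ _ _ _ eta eta0.
- by rewrite Ln andbT; lra.
- by move=> x; exact: box_psi_le1.
- by rewrite /radius; have := modulus_cst_ge0; lra.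
- by move=> j; rewrite card_ffun card_ord expn_gt0 resolution_gt0.
- by move=> j x; exact: grid_cover.
- exact: grid_entropy.
exists B; split => // w x xT.
exact: (hB w (exist _ x xT)).
Qed.

End Box.

(** * Truncation and finite sampling methods *)

Local Open Scope classical_set_scope.

Section UniformProbability.
Variables (R : realType) (T : finType) (t0 : T).
Local Open Scope ereal_scope.

(** Numbers from [#|T|] on decode to [t0]; [uniform_nat] gives them no mass. *)
Definition decode (w : nat) : T := nth t0 (enum T) w.

Lemma sum_decode (V : nmodType) (f : T -> V) :
  (\sum_(w < #|T|) f (decode w) = \sum_t f t)%R.
Proof.
by rewrite -[RHS]big_enum (big_nth t0) big_mkord -cardE.
Qed.

(** Finite types carry no canonical sigma-algebra, so the uniform law on [T] is
carried by [nat] through [decode]. *)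
Definition uniform_nat : probability nat R :=
  mnormalize (msum (fun k : nat => @dirac _ nat k R) #|T|) (@dirac _ nat 0%N R).

Lemma integral_uniform_nat (f : T -> \bar R) : (forall t, 0 <= f t) ->
  \int[uniform_nat]_w f (decode w) = (#|T|%:R^-1)%:E * \sum_t f t.
Proof.
move=> f0; have T0 : (0 < #|T|)%N by apply/card_gt0P; exists t0.
have mf : measurable_fun [set: nat] (f \o decode) by [].
set m := msum (fun k : nat => @dirac _ nat k R) #|T|.
have mT : m [set: nat] = (#|T|%:R)%:E.
  rewrite /m /msum /=; under eq_bigr => i _ do rewrite diracT.
  by rewrite sumEFin sumr_const card_ord.
have k0 : (0 <= #|T|%:R^-1 :> R)%R by rewrite invr_ge0.
rewrite (eq_measure_integral (mscale (NngNum k0) m)); last first.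
  move=> A _ _; rewrite /uniform_nat /= /mnormalize /mscale /= -/m mT.
  by rewrite eqe pnatr_eq0 eqn0Ngt T0 /= muleC.
rewrite ge0_integral_mscale // ge0_integral_measure_sum //; congr (_ * _).
rewrite -sum_decode; apply: eq_bigr => i _.
by rewrite integral_dirac // diracT mul1e.
Qed.

End UniformProbability.

Section LinfNorm.
Variables (R : realType) (d : nat).
Implicit Types (g : Defs.point R d -> R).

Lemma Linf_norm_ge0 g : (0 <= Linf_norm g)%E.
Proof. by apply: le_ereal_inf_tmp => _ [M [M0 _] <-]; rewrite lee_fin. Qed.

Lemma Linf_norm_le g (M : R) : (0 < d)%N ->
  (forall x, torus x -> `|g x| <= M) -> (Linf_norm g <= M%:E)%E.
Proof.
move=> d0 gM; apply: ereal_inf_lbound; exists M => //; split.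
  apply: le_trans (gM (fun=> 0) _) => // j.
  by rewrite lexx ltr01.
(* The exceptional set is empty, and degenerate boxes have volume 0 because [d > 0]. *)
move=> e e0; exists (fun _ _ => 0), (fun _ _ => 0); split=> //; split.
  by move=> x [/gM]; rewrite leNgt => /negP.
move=> m; rewrite big1 ?ltW // => n _; rewrite subrr.
by case: d d0 => // k _; rewrite big_ord_recl mul0r.
Qed.

End LinfNorm.

(** * Finite approximation of unconditional sums *)

Section UnconditionalSums.
Variables (R : realType) (I : choiceType).
Implicit Types (a b : I -> R) (s F : seq I).

Lemma le_sum_subset b s F : (forall k, 0 <= b k) -> uniq s -> {subset s <= F} ->
  \sum_(k <- s) b k <= \sum_(k <- F) b k.
Proof.
move=> b0; elim: s F => [|k s IH] F.
  by move=> _ _; rewrite big_nil sumr_ge0.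
move=> /= /andP[ks us] sF.
have kF : k \in F by apply: sF; rewrite mem_head.
rewrite (perm_big _ (perm_to_rem kF)) !big_cons lerD2l IH // => l ls.
have /(sF l) : l \in k :: s by rewrite inE ls orbT.
rewrite (perm_mem (perm_to_rem kF)) inE => /predU1P[lk|//].
by rewrite -lk ls in ks.
Qed.

Lemma sum_le_esum b s : (forall k, 0 <= b k) -> uniq s ->
  ((\sum_(k <- s) b k)%:E <= \esum_(k in [set: I]) (b k)%:E)%E.
Proof.
move=> b0 us; apply: esum_ge; exists [set` s].
  by split => //; exact: finite_seq.
by rewrite -fsbig_seq // sumEFin.
Qed.

Lemma esum_le_tail b F (delta : R) : (forall k, 0 <= b k) -> uniq F ->
  (forall s, uniq s -> (forall k, k \in s -> k \notin F) -> \sum_(k <- s) b k <= delta) ->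
  (\esum_(k in [set: I]) (b k)%:E <= (\sum_(k <- F) b k + delta)%:E)%E.
Proof.
move=> b0 uF tail; apply: ge_ereal_sup => _ [X [finX _] <-].
rewrite fsbig_finite //= sumEFin lee_fin (bigID (mem F)) /=; apply: lerD.
  rewrite -big_filter le_sum_subset ?filter_uniq //.
  by move=> k; rewrite mem_filter => /andP[].
rewrite -big_filter tail ?filter_uniq //.
by move=> k; rewrite mem_filter => /andP[].
Qed.

End UnconditionalSums.

(** The tail bound makes the sums of positive and negative parts finite, so [fine] returns their
    true values; each exceeds its partial sum by an amount between 0 and [delta]. *)
Lemma rsum_approx (R : realType) (d : nat) (a : mindex d -> R) (F : seq (mindex d)) (delta : R) :
  uniq F ->
  (forall s, uniq s -> (forall k, k \in s -> k \notin F) -> \sum_(k <- s) `|a k| <= delta) ->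
  `|rsum a - \sum_(k <- F) a k| <= delta.
Proof.
move=> uF tail.
have part (b : mindex d -> R) : (forall k, 0 <= b k <= `|a k|) ->
    \sum_(k <- F) b k <= fine (\esum_(k in [set: mindex d]) (b k)%:E)%E
      <= \sum_(k <- F) b k + delta.
  move=> hb; have b0 k : 0 <= b k by case/andP: (hb k).
  have h1 := sum_le_esum b0 uF.
  have h2 : (\esum_(k in [set: mindex d]) (b k)%:E <= (\sum_(k <- F) b k + delta)%:E)%E.
    apply: esum_le_tail => // s us sF; apply: le_trans (tail s us sF).
    by apply: ler_sum => k _; case/andP: (hb k).
  move: h1 h2; case: (\esum_(k in _) _)%E => //= x.
  by rewrite !lee_fin => -> ->.
have -> : \sum_(k <- F) a k = \sum_(k <- F) Num.max (a k) 0 - \sum_(k <- F) Num.max (- a k) 0.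
  rewrite -sumrB; apply: eq_bigr => k _.
  by rewrite !maxEle oppr_le0; case: (ltgtP (a k) 0) => h; rewrite ?h ?opprK; ring.
rewrite /rsum ler_norml.
have h (x : R) : 0 <= Num.max x 0 <= `|x|.
  by rewrite le_max lexx orbT ge_max ler_norm normr_ge0.
have hN (x : R) : 0 <= Num.max (- x) 0 <= `|x| by rewrite -normrN h.
have /andP[p1 p2] := part (fun k => Num.max (a k) 0) (fun k => h _).
have /andP[n1 n2] := part (fun k => Num.max (- a k) 0) (fun k => hN _).
by apply/andP; split; lra.
Qed.

(** * Truncation of Korobov functions, uniformly in the point *)

Section KorobovTruncation.
Variables (R : realType) (r beta0 beta1 : R) (d : nat).
Implicit Types (c : coeffs R d) (x : Defs.point R d).

Lemma unit_ball_sum c s : in_unit_ball c -> uniq s -> \sum_(k <- s) c k ^+ 2 <= 1.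
Proof.
move=> c1 us; rewrite -lee_fin; apply: le_trans c1.
by apply: sum_le_esum => // k; exact: sqr_ge0.
Qed.

Lemma korobov_fun_approx c x (F : seq (mindex d)) (delta : R) :
  in_unit_ball c -> uniq F -> 0 <= delta ->
  (forall s, uniq s -> (forall k, k \in s -> k \notin F) ->
     \sum_(k <- s) psi r beta0 beta1 k x ^+ 2 <= delta ^+ 2) ->
  `|korobov_fun r beta0 beta1 c x - \sum_(k <- F) c k * psi r beta0 beta1 k x| <= delta.
Proof.
move=> c1 uF delta0 tail; apply: rsum_approx => // s us sF.
rewrite -(@ler_pXn2r _ 2) ?nnegrE ?sumr_ge0 //.
under eq_bigr => k _ do rewrite normrM.
apply: le_trans (sqr_sum_le _ _ _ _) _; rewrite -[leRHS]mul1r.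
under eq_bigr => k _ do rewrite real_normK ?num_real //.
under [X in _ * X]eq_bigr => k _ do rewrite real_normK ?num_real //.
apply: ler_pM; rewrite ?tail ?unit_ball_sum ?sumr_ge0 // => k _; exact: sqr_ge0.
Qed.

Hypotheses (b0 : 0 < beta0) (b1 : 0 < beta1).
Hypothesis norm1 : (beta0%:E + beta1%:E * riemann_zeta (2 * r))%E = 1%E.

Definition box_seq N : seq (mindex d) := [seq box_freq k | k <- enum (box d N)].

Lemma box_seq_uniq N : uniq (box_seq N).
Proof. by rewrite map_inj_uniq ?enum_uniq //; exact: box_freq_inj. Qed.

Lemma sum_box_seq N (f : mindex d -> R) :
  \sum_(k <- box_seq N) f k = \sum_(k : box d N) f (box_freq k).
Proof. by rewrite big_map big_enum. Qed.

Lemma mem_box_seq N (k : mindex d) : (forall j, (absz (k j) <= N)%N) -> k \in box_seq N.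
Proof.
move=> kN; pose l : box d N := [ffun j => sval (cid (freq_surj (kN j)))].
apply/mapP; exists l; first by rewrite mem_enum.
by apply/ffunP => j; rewrite !ffunE; exact/esym/(svalP (cid (freq_surj (kN j)))).
Qed.

Lemma box_seq_exhaust (s : seq (mindex d)) : exists N, {subset s <= box_seq N}.
Proof.
exists (\max_(k <- s) \max_(j < d) absz (k j))%N => k ks; apply: mem_box_seq => j.
apply: leq_trans (_ : (\max_(j < d) absz (k j) <= _)%N).
  exact: (leq_bigmax (F := fun j => absz (k j))).
exact (@leq_bigmax_seq _ s xpredT (fun k : mindex d => \max_(j < d) absz (k j))%N k ks isT).
Qed.

Lemma sum_psi_sqr_le1 x (s : seq (mindex d)) : uniq s ->
  \sum_(k <- s) psi r beta0 beta1 k x ^+ 2 <= 1.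
Proof.
move=> us; have [N sN] := box_seq_exhaust s.
apply: le_trans (le_sum_subset _ us sN) _; first by move=> k; exact: sqr_ge0.
by rewrite sum_box_seq; exact: box_psi_le1.
Qed.

Definition weight1 (z : int) : R :=
  match z with
  | Posz 0 => beta0
  | Posz n.+1 => weight r beta1 n
  | Negz m => weight r beta1 m
  end.

Lemma weight1_ge0 z : 0 <= weight1 z.
Proof. by case: z => [[|n]|n] /=; rewrite ?weight_ge0 // ltW. Qed.

Lemma psi1_sqr_le z (t : R) : psi1 r beta0 beta1 z t ^+ 2 <= weight1 z.
Proof.
have amp m (u : R) : `|u| <= 1 ->
    (Num.sqrt beta1 * m.+1%:R `^ (- r) * u) ^+ 2 <= weight r beta1 m.
  move=> u1; rewrite !exprMn sqr_sqrtr ?(ltW b1) // -powR_mulrn ?powR_ge0 // -powRrM.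
  rewrite (_ : - r * 2%:R = - (2 * r)); last by ring.
  by rewrite -/(weight r beta1 m) ler_piMr ?weight_ge0 // -(real_normK (num_real u)) exprn_ile1.
case: z => [[|n]|n] /=; first by rewrite sqr_sqrtr ?(ltW b0).
  by apply: amp; exact: cos_max.
by apply: amp; exact: sin_max.
Qed.

Definition mweight (k : mindex d) : R := \prod_(j < d) weight1 (k j).

Lemma psi_sqr_le k x : psi r beta0 beta1 k x ^+ 2 <= mweight k.
Proof.
rewrite /psi -prodrXl; apply: ler_prod => j _.
by rewrite sqr_ge0 psi1_sqr_le.
Qed.

Lemma sum_mweight N :
  \sum_(k <- box_seq N) mweight k = (beta0 + 2 * \sum_(m < N) weight r beta1 m) ^+ d.
Proof.
rewrite sum_box_seq (sum_box _ (fun _ => weight1)) prodr_const card_ord.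
congr (_ ^+ d); rewrite big_sumType big_ord_recl /= -addrA; congr (_ + _).
by rewrite mulr_natl.
Qed.

(** The majorant [mweight] does not depend on [x]. A box whose [mweight] sum is within [delta] of
    the supremum over all boxes leaves at most [delta] for any finite set outside it. *)
Lemma psi_tail (delta : R) : 0 < delta -> exists N, forall s x, uniq s ->
  (forall k, k \in s -> k \notin box_seq N) ->
  \sum_(k <- s) psi r beta0 beta1 k x ^+ 2 <= delta.
Proof.
move=> delta0.
pose E := [set u | exists N, u = \sum_(k <- box_seq N) mweight k].
have mw0 k : 0 <= mweight k by apply: prodr_ge0 => j _; exact: weight1_ge0.
have supE : has_sup E.
  split; first by exists (\sum_(k <- box_seq 0) mweight k), 0%N.
  (* Each coordinate contributes [beta0 + 2 * S] with [beta0 + S <= 1]. Growth in [d] is harmless,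
     as it only affects the choice of [N]. *)
  exists (2 ^+ d) => _ [N ->]; rewrite sum_mweight.
  have := sum_weight_le1 b1 norm1 N.
  have w0 : 0 <= \sum_(m < N) weight r beta1 m.
    by apply: sumr_ge0 => m _; exact: weight_ge0.
  set S := \sum_(m < N) _ in w0 * => h.
  by rewrite lerXn2r ?nnegrE //; have := b0; lra.
have [_ [N ->] hN] := sup_adherent delta0 supE.
exists N => s x us sN.
apply: (@le_trans _ _ (\sum_(k <- s) mweight k)).
  by apply: ler_sum => k _; exact: psi_sqr_le.
have [M sM] := box_seq_exhaust (s ++ box_seq N).
have usN : uniq (s ++ box_seq N).
  rewrite cat_uniq us box_seq_uniq andbT /=; apply/hasPn => k kN.
  by apply/negP => /sN; rewrite kN.
have := le_sum_subset mw0 usN sM; rewrite big_cat /=.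
have : \sum_(k <- box_seq M) mweight k <= sup E.
  by apply: ub_le_sup; [case: supE|exists M].
lra.
Qed.

End KorobovTruncation.

(** * From finite sample spaces to randomized methods *)

Section Achievable.
Variables (R : realType) (r beta0 beta1 : R) (d : nat).
Hypothesis d0 : (0 < d)%N.

Lemma ran_achievable_finite (n : nat) (T : finType) (t0 : T) (eps : R)
  (L : T -> 'I_n -> coeffs R d -> R) (phi : T -> ('I_n -> R) -> Defs.point R d -> R) :
  (forall t i, cont_lin_functional (L t i)) ->
  (forall c, in_unit_ball c -> exists B : T -> R,
     (forall t x, torus x ->
        `|korobov_fun r beta0 beta1 c x - phi t (fun i => L t i c) x| <= B t) /\
     avg B <= eps) ->
  ran_achievable d r beta0 beta1 eps n.
Proof.
move=> Lcont err.
exists _, nat, (uniform_nat R T),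
  (RanMethod (fun w => L (decode t0 w)) (fun w => phi (decode t0 w))); split.
  by move=> w i; exact: Lcont.
(* Every subset of [nat] is measurable, hence so is the error. *)
split; first by [].
apply: ge_ereal_sup => _ [c c1 <-].
have [B [hB avgB]] := err c c1.
pose f t := Linf_norm (fun x => korobov_fun r beta0 beta1 c x - phi t (fun i => L t i c) x).
rewrite (@integral_uniform_nat R T t0 f); last by move=> t; exact: Linf_norm_ge0.
apply: (@le_trans _ _ (avg B)%:E); last by rewrite lee_fin.
rewrite /avg EFinM lee_pmul2l ?lte_fin ?invr_gt0 ?ltr0n //; last first.
  by apply/card_gt0P; exists t0.
rewrite -sumEFin; apply: lee_sum => t _.
by apply: Linf_norm_le => // x xT; exact: hB.
Qed.

End Achievable.

Lemma cont_lin_signs_dot (R : realType) (d N : nat) (e : {ffun box d N -> bool}) :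
  cont_lin_functional (fun c : coeffs R d => signs_dot (fun k => c (box_freq k)) e).
Proof.
split=> [a c1 c2 _ _|].
  rewrite /signs_dot mulr_sumr -big_split; apply: eq_bigr => k _.
  by rewrite /= mulrDl mulrA.
exists (Num.sqrt #|{: box d N}|%:R) => c _.
rewrite real_normK ?num_real // sqr_sqrtr //.
apply: (@le_trans _ _ (#|{: box d N}|%:R * \sum_(k : box d N) c (box_freq k) ^+ 2)%:E).
  by rewrite lee_fin; exact: signs_dot_sqr.
rewrite EFinM lee_wpmul2l ?lee_fin //.
rewrite -(sum_box_seq _ (fun k => c k ^+ 2)).
by apply: sum_le_esum (box_seq_uniq _ _) => k; exact: sqr_ge0.
Qed.

(** * Admissible sample sizes *)

Section UpperBound.
Variables (R : realType) (r beta0 beta1 : R).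
Hypotheses (b0 : 0 < beta0) (b1 : 0 < beta1).
Hypothesis norm1 : (beta0%:E + beta1%:E * riemann_zeta (2 * r))%E = 1%E.
Variables (d p : nat).
Hypotheses (d0 : (0 < d)%N) (p0 : (0 < p)%N) (p_r : 1 + p%:R^-1 < 2 * r).

Lemma ran_achievable0 (eps : R) : 1 <= eps -> ran_achievable d r beta0 beta1 eps 0.
Proof.
move=> eps1; apply: (@ran_achievable_finite _ _ _ _ _ d0 _ _ tt _
  (fun _ _ _ => 0) (fun _ _ _ => 0)) => [_ [] //|c c1].
exists (fun=> 1); split; last by rewrite avg_cst ?card_unit.
move=> _ x _; have := @korobov_fun_approx R r beta0 beta1 d c x [::] 1 c1 isT ler01.
rewrite big_nil expr1n; apply => s us _; exact: sum_psi_sqr_le1.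
Qed.

(** Error budget: [eps / 2] for the chaining bound, [eps / 4] for its slack [eta], and [eps / 4] for
    truncation to the box. *)
Lemma ran_achievable_sampling (n : nat) (eps : R) : 0 < eps ->
  dlogd R d <= n%:R ->
  sampling_cst r beta1 p * Num.sqrt (dlogd R d / n%:R) <= eps / 2 ->
  ran_achievable d r beta0 beta1 eps n.
Proof.
move=> eps0 Ln hn.
have e4 : 0 < eps / 4 by rewrite divr_gt0.
have n0 : 0 < n%:R :> R by apply: lt_le_trans Ln; exact: lt_le_trans (dlogd_ge1 _ d0).
have [N hN] := psi_tail d b0 b1 norm1 (exprn_gt0 2 e4).
pose t0 : {ffun 'I_n -> {ffun box d N -> bool}} := [ffun=> [ffun=> true]].
apply: (@ran_achievable_finite _ _ _ _ _ d0 _ _ t0 _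
  (fun w i c => signs_dot (fun k => c (box_freq k)) (w i))
  (fun w v x => n%:R^-1 * \sum_i v i * signs_dot (box_psi r beta0 beta1 x) (w i))).
  by move=> w i; exact: cont_lin_signs_dot.
move=> c c1; pose a (k : box d N) := c (box_freq k).
have a1 : \sum_k a k ^+ 2 <= 1.
  by rewrite -(sum_box_seq _ (fun k => c k ^+ 2)); apply: unit_ball_sum (box_seq_uniq _ _).
have [B [hB avgB]] := box_sampling b0 b1 norm1 d0 p0 p_r Ln a1 e4.
exists (fun w => B w + eps / 4); split; last first.
  by rewrite avgD avg_cst ?card_samples //; lra.
move=> w x xT.
have := korobov_fun_approx (r := r) (beta0 := beta0) (beta1 := beta1) (x := x) c1
  (box_seq_uniq d N) (ltW e4) (fun s us sF => hN s x us sF).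
rewrite sum_box_seq => h1; have h2 := hB w x xT.
set f := korobov_fun _ _ _ _ _ in h1 *; set S := \sum_(k : box d N) _ in h1.
(* The output is its mean [S], the box part of [f] at [x], plus the centred fluctuation. *)
have -> : n%:R^-1 * \sum_i signs_dot a (w i) * signs_dot (box_psi r beta0 beta1 x) (w i) =
    n%:R^-1 * chaos a (box_psi r beta0 beta1 x) w + S.
  rewrite /chaos sumrB sumr_const card_ord mulrBr -[X in _ - _ * X]mulr_natl.
  by rewrite mulKf ?gt_eqF // subrK.
rewrite opprD addrCA addrC -opprB opprB; apply: le_trans (ler_normB _ _) _.
lra.
Qed.

End UpperBound.

Local Close Scope classical_set_scope.
Unset Implicit Arguments.

Theorem theorem3p7 (R : realType) (r beta0 beta1 : R) :
  1 / 2 < r -> 0 < beta0 -> 0 < beta1 ->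
  (beta0%:E + beta1%:E * riemann_zeta (2 * r))%E = 1%E ->
  exists C : R, 0 < C /\
    forall (d : nat) (eps : R), (0 < d)%N -> 0 < eps ->
      (n_ran d r beta0 beta1 eps
         <= (C * eps ^- 2 * d%:R * (1 + ln (d%:R : R)))%:E)%E.
Proof.
move=> r_gt b0 b1 norm1.
have r1 : 0 < 2 * r - 1 by lra.
(* The successor makes [p] strictly larger than [(2 * r - 1)^-1], hence [1 / p < 2 * r - 1]. *)
set p := (Num.truncn (2 * r - 1)^-1).+1.
have p_r : 1 + p%:R^-1 < 2 * r.
  rewrite -ltrBrDl invf_plt ?posrE ?ltr0n //; exact: truncnS_gt.
set C1 := 1 + `|sampling_cst r beta1 p|.
have C11 : 1 <= C1 by rewrite lerDl.
have C0 : 0 < 4 * C1 ^+ 2 + 1 by rewrite addr_gt0 // mulr_gt0 // exprn_gt0 //; lra.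
exists (4 * C1 ^+ 2 + 1); split => // d eps d0 eps0.
have L1 := dlogd_ge1 R d0.
rewrite -[X in (_ <= X%:E)%E]mulrA -/(dlogd R d).
have [eps1|eps1] := lerP 1 eps.
  apply: le_trans (_ : (0%:R : R)%:E <= _)%E.
    by apply: ereal_inf_lbound; exists 0%N => //; exact: ran_achievable0.
  rewrite lee_fin mulr_ge0 ?(le_trans ler01 L1) //.
  by rewrite mulr_ge0 ?(ltW C0) // invr_ge0 sqr_ge0.
(* Solves [C1 * sqrt (dlogd / q) = eps / 2]. Rounding up to [n] adds at most 1, which the summand 1
   of the constant pays for since [eps ^- 2 * dlogd R d >= 1]. *)
set q := 4 * C1 ^+ 2 * eps ^- 2 * dlogd R d.
have i1 : 1 <= eps ^- 2 by rewrite invf_ge1 ?exprn_gt0 // exprn_ile1 // ltW.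
have C21 : 1 <= C1 ^+ 2 by rewrite exprn_ege1.
have q0 : 0 <= q by rewrite mulr_ge0 ?(le_trans ler01 L1) // mulr_ge0 //; lra.
have /andP[nq qn] := truncn_itv q0.
set n := (Num.truncn q).+1 in qn.
have n0 : 0 < n%:R :> R by rewrite ltr0n.
have Lq : dlogd R d <= q.
  have h : 1 <= 4 * C1 ^+ 2 * eps ^- 2 by rewrite -[1]mulr1 ler_pM //; lra.
  by rewrite ler_peMl //; lra.
apply: (@le_trans _ _ (n%:R : R)%:E).
  apply: ereal_inf_lbound; exists n => //.
  apply: (@ran_achievable_sampling _ _ _ _ b0 b1 norm1 d p) => //.
    by lra.
  apply: (@le_trans _ _ (C1 * (eps / (2 * C1)))); last first.
    by rewrite le_eqVlt; apply/orP; left; apply/eqP; field; lra.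
  apply: (@le_trans _ _ (C1 * Num.sqrt (dlogd R d / n%:R))).
    by rewrite ler_wpM2r ?sqrtr_ge0 // (le_trans (ler_norm _)) // lerDr.
  rewrite ler_wpM2l //; first by lra.
  have e0 : 0 <= eps / (2 * C1) by rewrite divr_ge0 //; lra.
  rewrite -(ger0_norm e0) -sqrtr_sqr ler_wsqrtr // ler_pdivrMr //.
  apply: (@le_trans _ _ ((eps / (2 * C1)) ^+ 2 * q)).
    rewrite le_eqVlt /q; apply/orP; left; apply/eqP; field.
    by rewrite !gt_eqF //; lra.
  by rewrite ler_wpM2l ?sqr_ge0 // ltW.
rewrite lee_fin /n -natr1 [(_ + 1) * _]mulrDl mul1r mulrDl -/q.
by rewrite lerD // -[1]mulr1 ler_pM.
Qed.
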